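(* Let $\mathcal{S}_n$ be the number of triangles (ears) having at least two sides on the perimeter of $P_n$ in a uniformly random triangulation $\mathcal{T}_n$ of a convex $n$-gon $P_n$, and let $g_n(z)=\mathbb{E}(z^{\mathcal{S}_n})$. Then: (I) For all $n\ge 4$, $$g_n(z)=1+\frac{1}{C_{n-2}}\sum_{j=0}^{n-3}C_j\left(\binom{j+1}{n-2-j}+2\binom{j+1}{n-3-j}\right)(z-1)^{n-2-j}.$$ (II) For all $n\ge 4$, $\mathbb{E}(\mathcal{S}_n)=\dfrac{n(n-1)}{2(2n-5)}$. (III) For all $n\ge 6$, $\mathrm{Var}(\mathcal{S}_n)=\dfrac{n(n-1)(n-4)(n-5)}{2(2n-5)^2(2n-7)}$.
   Context: $P_n$ has vertices $v_{n,1},\dots,v_{n,n}$ in clockwise order. A triangulation of $P_n$ is a set of $n-3$ noncrossing diagonals partitioning $P_n$ into $n-2$ triangles; there are $C_{n-2}$ of them, where $C_k=\frac{1}{k+1}\binom{2k}{k}$, and $\mathcal{T}_n$ is chosen uniformly among them. Equivalently $\mathcal{S}_n=\sum_{\Delta\in\mathcal{T}_n}f_n(\Delta)$, where for $1\le l<j<r\le n$ the weight $f_{n,l,j,r}$ of the triangle with vertices $v_{n,l},v_{n,j},v_{n,r}$ is $1$ if $(j,r)=(l+1,l+2)$ with $r\le n$, or $(l,j,r)=(1,n-1,n)$, or $(l,j,r)=(1,2,n)$, and is $0$ otherwise. Here $z$ is a complex variable and $\binom{a}{b}=0$ when $b>a\ge 0$. *)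

(* Defs.v *)
From HB Require Import structures.
From mathcomp Require Import all_boot all_order all_algebra.
From mathcomp Require Import complex reals.

Set Implicit Arguments.
Unset Strict Implicit.
Unset Printing Implicit Defensive.

Import Order.TTheory GRing.Theory Num.Theory.

(* The index i : 'I_n stands for the (i+1)-st vertex of the convex n-gon in
   clockwise order. A chord is encoded by its endpoints listed in increasing
   order, a triangle by its three vertices l < j < r. *)
Section Polygon.

Variable n : nat.

Definition perimeter_side (p : 'I_n * 'I_n) : bool :=
  (p.1.+1 == p.2 :> nat) || (p.1 == 0 :> nat) && (p.2.+1 == n).

Definition diagonal (p : 'I_n * 'I_n) : bool :=
  (p.1 < p.2) && ~~ perimeter_side p.

(* In a convex polygon two chords meet at an interior point exactly when their
   endpoints strictly interleave; diagonals sharing an endpoint do not cross. *)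
Definition crossing (p q : 'I_n * 'I_n) : bool :=
  [&& p.1 < q.1, q.1 < p.2 & p.2 < q.2]
  || [&& q.1 < p.1, p.1 < q.2 & q.2 < p.2].

Definition triangulations : {set {set 'I_n * 'I_n}} :=
  [set D : {set 'I_n * 'I_n} |
    [&& #|D| == n - 3,
        [forall p in D, diagonal p]
      & [forall p in D, forall q in D, ~~ crossing p q]]].

(* No diagonal of D can enter a triangle all of whose sides are perimeter
   sides or elements of D, so for a triangulation D these triangles are exactly
   the n - 2 cells it cuts out. *)
Definition triangles (D : {set 'I_n * 'I_n}) : {set 'I_n * 'I_n * 'I_n} :=
  [set t : 'I_n * 'I_n * 'I_n |
    let: (l, j, r) := t in
    [&& l < j, j < r,
        perimeter_side (l, j) || ((l, j) \in D),
        perimeter_side (j, r) || ((j, r) \in D)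
      & perimeter_side (l, r) || ((l, r) \in D)]].

Definition ears (D : {set 'I_n * 'I_n}) : nat :=
  #|[set t in triangles D |
      let: (l, j, r) := t in
      2 <= perimeter_side (l, j) + perimeter_side (j, r)
           + perimeter_side (l, r)]|.

End Polygon.

Local Open Scope ring_scope.

Definition catalan (F : numFieldType) (k : nat) : F :=
  'C(2 * k, k)%:R / k.+1%:R.

(* Expectation and variance of X under the uniform distribution on A. *)
Definition uexpect (F : numFieldType) (T : finType) (A : {set T})
    (X : T -> F) : F :=
  (\sum_(x in A) X x) / #|A|%:R.

Definition uvariance (F : realFieldType) (T : finType) (A : {set T})
    (X : T -> F) : F :=
  uexpect A (fun x => (X x - uexpect A X) ^+ 2).

Definition ear_pgf (R : realType) (n : nat) (z : R[i]) : R[i] :=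
  uexpect (triangulations n) (fun D => z ^+ ears D).

(* Main.v *)
Require Import Defs.
From HB Require Import structures.
From mathcomp Require Import all_boot all_order all_algebra.
From mathcomp Require Import complex reals.
From mathcomp Require Import zify ring lra.

Set Implicit Arguments.
Unset Strict Implicit.
Unset Printing Implicit Defensive.

Import Order.TTheory GRing.Theory Num.Theory.

(* Cutting off an ear with tip i identifies the triangulations of the n-gon
   containing the chord from i - 1 to i + 1 with all triangulations of the
   (n - 1)-gon. Repeating this, the tips of a triangulation contain a given
   k-set K with probability t (n - k) / t n if no two elements of K are
   adjacent, and 0 otherwise, t n being the number of triangulations. Counting
   the k-subsets of the n-cycle without adjacent elements gives the binomial
   moments of the number of ears, hence everything in terms of t. Finally,
   every triangulation of an n-gon, n >= 4, has an ear, so the generating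
   function vanishes at z = 0; the resulting linear recurrence determines t,
   and the Catalan numbers satisfy it because the coefficient of X^(m - 1) in
   ((1 + X)^2 - 1)^m is 0. *)

(** * Cutting off a vertex: index arithmetic *)

(** The test sorts the endpoints: chords are stored in increasing order, and wrapping around at
    vertex [0] or [n - 1] would reverse the two neighbours of [i]. *)
Definition cut n (i : 'I_n) : 'I_n * 'I_n :=
  if ord_pred i < ordS i then (ord_pred i, ordS i) else (ordS i, ord_pred i).

Lemma val_ordS n (i : 'I_n) : ordS i = (if i.+1 == n then 0 else i.+1) :> nat.
Proof.
rewrite /=; case: eqP => [->|ne]; first by rewrite modnn.
by rewrite modn_small //; have := ltn_ord i; lia.
Qed.

Lemma val_ord_pred n (i : 'I_n) :
  ord_pred i = (if i == 0 :> nat then n.-1 else i.-1) :> nat.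
Proof.
have := ltn_ord i; rewrite /=; case: eqP => [->|ne] lt_in.
  by rewrite modn_small //; lia.
rewrite (_ : (i + n).-1 = i.-1 + n); last by lia.
by rewrite modnDr modn_small //; lia.
Qed.

(** Turns [cut] into numerical equations, so that the geometric facts below become linear
    arithmetic. *)
Lemma cut_cases n (i : 'I_n) : 2 < n ->
  [\/ [/\ i = 0 :> nat, (cut i).1 = 1 :> nat & (cut i).2 = n.-1 :> nat],
      [/\ i.+1 = n, (cut i).1 = 0 :> nat & (cut i).2 = n.-2 :> nat]
    | [/\ 0 < i < n.-1, (cut i).1 = i.-1 :> nat & (cut i).2 = i.+1 :> nat]].
Proof.
move=> n_gt2; have lt_in := ltn_ord i.
have [i0 | i_gt0] := posnP i; first constructor 1.
  by rewrite /cut; case: ifP; rewrite !val_ordS !val_ord_pred /= i0 /=;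
    case: eqP => ?; split; lia.
have [in1 | ni] := eqVneq i.+1 n; [constructor 2|constructor 3];
  by rewrite /cut; case: ifP; rewrite !val_ordS !val_ord_pred /=;
    repeat case: eqP => ?; split; lia.
Qed.

Definition liftp n (i : 'I_n) (p : 'I_n.-1 * 'I_n.-1) : 'I_n * 'I_n :=
  (lift i p.1, lift i p.2).

Lemma liftp_inj n (i : 'I_n) : injective (liftp i).
Proof.
by move=> [a b] [c d] /pair_equal_spec[/lift_inj/= -> /lift_inj/= ->].
Qed.

Lemma ltn_lift n (i : 'I_n) (a b : 'I_n.-1) : (lift i a < lift i b) = (a < b).
Proof. by rewrite !ltnNge leq_bump2. Qed.

Lemma crossing_liftp n (i : 'I_n) p q :
  crossing (liftp i p) (liftp i q) = crossing p q.
Proof. by rewrite /crossing !ltn_lift. Qed.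

Lemma pair_val_eq n (p q : 'I_n * 'I_n) :
  (p == q) = (p.1 == q.1 :> nat) && (p.2 == q.2 :> nat).
Proof. by []. Qed.

(** Deleting vertex [i] leaves a gap that only the chord [cut i] closes; any other side of the
    smaller polygon was a side before. *)
Lemma perimeter_side_liftp n (i : 'I_n) (p : 'I_n.-1 * 'I_n.-1) :
  2 < n -> p.1 < p.2 ->
  perimeter_side p = perimeter_side (liftp i p) || (liftp i p == cut i).
Proof.
move: p => [a b] n_gt2 /= lt_ab; have lt_in := ltn_ord i.
have lt_bn := ltn_ord b.
rewrite pair_val_eq /perimeter_side /= /bump.
case: (cut_cases i n_gt2) => -[? -> ->];
  case: (leqP i a) => ?; case: (leqP i b) => ?; lia.
Qed.

Lemma ltn_cut n (i : 'I_n) : 2 < n -> (cut i).1 < (cut i).2.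
Proof.
move=> n_gt2; have lt_in := ltn_ord i.
by case: (cut_cases i n_gt2) => -[? -> ->]; lia.
Qed.

Lemma diagonal_cut n (i : 'I_n) : 3 < n -> diagonal (cut i).
Proof.
move=> n_gt3; have lt_in := ltn_ord i; have n_gt2 := ltnW n_gt3.
rewrite /diagonal /perimeter_side.
by case: (cut_cases i n_gt2) => -[? -> ->]; lia.
Qed.

Lemma crossingC n : symmetric (@crossing n).
Proof. by move=> p q; rewrite /crossing orbC. Qed.

Lemma crossing_cut_liftp n (i : 'I_n) (p : 'I_n.-1 * 'I_n.-1) :
  2 < n -> p.1 < p.2 ->
  crossing (cut i) (liftp i p) = false.
Proof.
move: p => [a b] n_gt2 /= lt_ab; have lt_in := ltn_ord i.
have lt_bn := ltn_ord b.
rewrite /crossing /= /bump; case: (cut_cases i n_gt2) => -[? -> ->];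
  case: (leqP i a) => ?; case: (leqP i b) => ?; lia.
Qed.

(** The other endpoint of a diagonal at [i] is not a neighbour of [i], so [cut i] separates the two
    endpoints. *)
Lemma crossing_cut n (i : 'I_n) p : 2 < n -> diagonal p ->
  (p.1 == i) || (p.2 == i) -> crossing (cut i) p.
Proof.
move: p => [a b] n_gt2; have lt_in := ltn_ord i; have lt_bn := ltn_ord b.
rewrite /diagonal /perimeter_side -!val_eqE /= => diag inc.
rewrite /crossing /=; case: (cut_cases i n_gt2) => -[? -> ->]; lia.
Qed.

Lemma liftp_onto n (i : 'I_n) (p : 'I_n * 'I_n) :
  ~~ ((p.1 == i) || (p.2 == i)) -> exists q, p = liftp i q.
Proof.
case: p => a b; rewrite negb_or /= ![_ == i]eq_sym => /andP[ia ib].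
have [a' -> _] := unlift_some ia; have [b' -> _] := unlift_some ib.
by exists (a', b').
Qed.

(** Skipping [i] preserves the cyclic order, so successors agree unless [i] itself is the successor
    that was skipped. *)
Lemma lift_ordS n (i : 'I_n) (k : 'I_n.-1) : 2 < n ->
  ordS (lift i k) != i -> lift i (ordS k) = ordS (lift i k).
Proof.
move=> n_gt2; have lt_in := ltn_ord i; have lt_kn := ltn_ord k.
rewrite -(inj_eq (@ord_inj _)) val_ordS => ne; apply: ord_inj.
rewrite [RHS]val_ordS (_ : lift i (ordS k) = bump i (ordS k) :> nat) // val_ordS.
move: ne; rewrite /= /bump.
case: (leqP i k) => ?; case: (_ =P n) => ?; case: (_ =P n.-1) => ? /eqP ?; lia.
Qed.

Lemma lift_ord_pred n (i : 'I_n) (k : 'I_n.-1) : 2 < n ->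
  ord_pred (lift i k) != i -> lift i (ord_pred k) = ord_pred (lift i k).
Proof.
move=> n_gt2; have lt_in := ltn_ord i; have lt_kn := ltn_ord k.
rewrite -(inj_eq (@ord_inj _)) val_ord_pred => ne; apply: ord_inj.
rewrite [RHS]val_ord_pred (_ : lift i (ord_pred k) = bump i (ord_pred k) :> nat) //.
rewrite val_ord_pred.
move: ne; rewrite /= /bump.
case: (leqP i k) => ?; case: (posnP k) => [k0|?];
  rewrite /= ?k0 ?add0n ?add1n /= => /eqP ?; try lia.
Qed.

Lemma liftp_cut n (i : 'I_n) (k : 'I_n.-1) : 2 < n ->
  ordS (lift i k) != i -> ord_pred (lift i k) != i ->
  liftp i (cut k) = cut (lift i k).
Proof.
move=> n_gt2 neS neP; rewrite /cut -lift_ordS // -lift_ord_pred // ltn_lift.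
by case: ifP.
Qed.

(** * Noncrossing sets of diagonals and the removal of a vertex *)

Definition noncrossing n (D : {set 'I_n * 'I_n}) : bool :=
  [forall p in D, diagonal p]
  && [forall p in D, forall q in D, ~~ crossing p q].

Lemma noncrossingP n (D : {set 'I_n * 'I_n}) :
  reflect ({in D, forall p, diagonal p} /\
           {in D &, forall p q, ~~ crossing p q}) (noncrossing D).
Proof.
apply: (iffP andP) => -[H1 H2]; split.
- by move=> p pD; move/forall_inP: H1; apply.
- by move=> p q pD qD; move/forall_inP: H2 => /(_ p pD)/forall_inP; apply.
- exact/forall_inP.
- by apply/forall_inP => p pD; apply/forall_inP => q qD; apply: H2.
Qed.

Lemma in_triangulations n (D : {set 'I_n * 'I_n}) :
  (D \in triangulations n) = (#|D| == n - 3) && noncrossing D.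
Proof. by rewrite inE. Qed.

Definition isolated n (i : 'I_n) (D : {set 'I_n * 'I_n}) : Prop :=
  {in D, forall p, ~~ ((p.1 == i) || (p.2 == i))}.

Lemma cut_isolated n (i : 'I_n) (D : {set 'I_n * 'I_n}) :
  2 < n -> noncrossing D -> cut i \in D -> isolated i D.
Proof.
move=> n_gt2 /noncrossingP[diagD ncD] cutD p pD.
by apply: contra (ncD _ _ cutD pD); apply: crossing_cut => //; apply: diagD.
Qed.

(** The chord [cut i] is dropped because it becomes a side of the smaller polygon. *)
Definition restrict n (i : 'I_n) (D : {set 'I_n * 'I_n}) :
    {set 'I_n.-1 * 'I_n.-1} :=
  liftp i @^-1: (D :\ cut i).

Definition extend n (i : 'I_n) (D : {set 'I_n.-1 * 'I_n.-1}) :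
    {set 'I_n * 'I_n} :=
  cut i |: liftp i @: D.

Lemma diagonal_liftp n (i : 'I_n) (p : 'I_n.-1 * 'I_n.-1) : 2 < n ->
  diagonal p = diagonal (liftp i p) && (liftp i p != cut i).
Proof.
move=> n_gt2; rewrite /diagonal ltn_lift; case: ltnP => //= lt_p.
by rewrite (perimeter_side_liftp i) // negb_or.
Qed.

Lemma restrict_noncrossing n (i : 'I_n) (D : {set 'I_n * 'I_n}) :
  2 < n -> noncrossing D -> noncrossing (restrict i D).
Proof.
move=> n_gt2 /noncrossingP[diagD ncD]; apply/noncrossingP; split.
  move=> p; rewrite !inE => /andP[np pD].
  by rewrite (diagonal_liftp i) // np diagD.
move=> p q; rewrite !inE => /andP[np pD] /andP[nq qD].
by rewrite -(crossing_liftp i) ncD.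
Qed.

Lemma liftp_restrict n (i : 'I_n) (D : {set 'I_n * 'I_n}) :
  isolated i D -> liftp i @: restrict i D = D :\ cut i.
Proof.
move=> isoD; apply/setP => p; apply/imsetP/idP => [[q qD ->]|pD].
  by rewrite inE in qD.
have [q def_p] : exists q, p = liftp i q.
  by apply/liftp_onto/isoD; move: pD; rewrite inE => /andP[].
by exists q; rewrite // inE -def_p.
Qed.

Lemma card_restrict n (i : 'I_n) (D : {set 'I_n * 'I_n}) :
  isolated i D -> #|D| = (cut i \in D) + #|restrict i D|.
Proof.
move=> isoD; rewrite (cardsD1 (cut i)) -liftp_restrict //.
by rewrite card_imset //; apply: liftp_inj.
Qed.

(** Nothing in [D] lifts to [cut i]: a chord that did would be a side of the smaller polygon, not a
    diagonal. *)
Lemma extendK n (i : 'I_n) (D : {set 'I_n.-1 * 'I_n.-1}) :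
  2 < n -> noncrossing D -> restrict i (extend i D) = D.
Proof.
move=> n_gt2 /noncrossingP[diagD _]; apply/setP => p; rewrite !inE.
case: eqP => //= [cut_p | _]; last by rewrite (mem_imset _ _ (@liftp_inj _ i)).
apply/esym/negP => /diagD; rewrite (diagonal_liftp i) // cut_p eqxx.
by rewrite andbF.
Qed.

Lemma restrictK n (i : 'I_n) (D : {set 'I_n * 'I_n}) :
  isolated i D -> cut i \in D -> extend i (restrict i D) = D.
Proof. by move=> isoD cutD; rewrite /extend liftp_restrict // setD1K. Qed.

Lemma extend_noncrossing n (i : 'I_n) (D : {set 'I_n.-1 * 'I_n.-1}) :
  3 < n -> noncrossing D -> noncrossing (extend i D).
Proof.
move=> n_gt3 /noncrossingP[diagD ncD]; have n_gt2 := ltnW n_gt3.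
have lt_diag (p : 'I_n.-1 * 'I_n.-1) : p \in D -> p.1 < p.2.
  by move=> /diagD/andP[].
apply/noncrossingP; split.
  move=> p; rewrite !inE => /orP[/eqP->|/imsetP[q qD ->]].
    exact: diagonal_cut.
  by have := diagD q qD; rewrite (diagonal_liftp i) // => /andP[].
move=> p q; rewrite !inE.
case/orP=> [/eqP->|/imsetP[p' pD ->]]; case/orP=> [/eqP->|/imsetP[q' qD ->]].
- by rewrite /crossing !ltnn.
- by rewrite crossing_cut_liftp // lt_diag.
- by rewrite crossingC crossing_cut_liftp // lt_diag.
- by rewrite crossing_liftp ncD.
Qed.

(* The vertex following the lower end of a shortest diagonal: a diagonal ending
   there would be trapped under the shortest one, hence shorter. *)
Lemma exists_isolated n (D : {set 'I_n * 'I_n}) :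
  noncrossing D -> D != set0 -> exists i, isolated i D.
Proof.
move=> /noncrossingP[diagD ncD] /set0Pn[p0 p0D].
case: (arg_minnP (fun p : 'I_n * 'I_n => p.2 - p.1) p0D) => -[a b] /=.
move=> abD min_ab.
have := diagD _ abD; rewrite /diagonal /perimeter_side /= => diag_ab.
have lt_bn := ltn_ord b; have lt_an : a.+1 < n by lia.
exists (Ordinal lt_an) => -[c d] cdD; rewrite -!val_eqE /=.
have := min_ab _ cdD; have := ncD _ _ abD cdD; have := diagD _ cdD.
rewrite /diagonal /crossing /perimeter_side /=; lia.
Qed.

(** Induction on [n]: removing an isolated vertex loses at most one chord, namely [cut i]. *)
Lemma card_noncrossing n (D : {set 'I_n * 'I_n}) :
  noncrossing D -> #|D| <= n - 3.
Proof.
elim: n D => [|n IHn] D ncD.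
  by rewrite leqNgt; apply/negP => /card_gt0P[[[]]].
have [->|D_n0] := eqVneq D set0; first by rewrite cards0.
have [p pD] := set0Pn _ D_n0.
have n_gt2 : 2 < n.
  have /noncrossingP[diagD _] := ncD.
  have := diagD _ pD; rewrite /diagonal /perimeter_side.
  by have := ltn_ord p.2; case: p {pD} => a b /=; lia.
have [i isoD] := exists_isolated ncD D_n0.
rewrite (card_restrict isoD).
have le_r := IHn _ (restrict_noncrossing i (ltnW n_gt2 : 2 < n.+1) ncD).
by apply: leq_trans (leq_add (leq_b1 _) le_r) _; lia.
Qed.

(** At an isolated vertex [i] the chord [cut i] must be present; otherwise all [n - 3] diagonals
    would survive in the [(n - 1)]-gon, which admits at most [n - 4]. *)
Lemma exists_cut n (D : {set 'I_n * 'I_n}) :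
  3 < n -> D \in triangulations n -> exists i, cut i \in D.
Proof.
case: n D => // n D n_gt2; rewrite in_triangulations => /andP[/eqP cardD ncD].
have D_n0 : D != set0 by rewrite -card_gt0 cardD; lia.
have [i isoD] := exists_isolated ncD D_n0.
exists i; apply/negPn/negP => /negbTE cutD.
have := card_restrict isoD; rewrite cutD cardD add0n => card_r.
have := card_noncrossing (restrict_noncrossing i (ltnW n_gt2 : 2 < n.+1) ncD).
by rewrite -card_r /=; lia.
Qed.

(** * Triangulations with prescribed tips *)

Lemma triangulations_small n : n <= 3 -> triangulations n = [set set0].
Proof.
move=> n_le3; apply/setP => D; rewrite in_triangulations inE.
rewrite (_ : n - 3 = 0); last by lia.
rewrite cards_eq0; case: eqP => //= ->; apply/noncrossingP.
by split=> [p|p q]; rewrite inE.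
Qed.

(* The first disjunct matters only for n = 3, where the chord cut i is itself a
   side of the triangle; thanks to it, tip_extend also covers n = 4. *)
Definition tip n (i : 'I_n) (D : {set 'I_n * 'I_n}) : bool :=
  perimeter_side (cut i) || (cut i \in D).

Definition sparse n (K : {set 'I_n}) : bool :=
  [forall i in K, ordS i \notin K].

Definition tipped n (K : {set 'I_n}) : {set {set 'I_n * 'I_n}} :=
  [set D in triangulations n | [forall i in K, tip i D]].

Lemma tip_diag n (i : 'I_n) (D : {set 'I_n * 'I_n}) :
  3 < n -> tip i D = (cut i \in D).
Proof.
move=> n_gt3; have /andP[_] := diagonal_cut i n_gt3.
by rewrite /tip; case: perimeter_side.
Qed.

Lemma sparse_ord_pred n (K : {set 'I_n}) i :
  sparse K -> i \in K -> ord_pred i \notin K.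
Proof.
move=> /forall_inP spK iK; apply/negP => /spK.
by rewrite ord_predK iK.
Qed.

(** The two inequalities say that [lift i k] is not adjacent to [i], so that its neighbours are the
    same before and after inserting [i]. *)
Lemma tip_extend n (i : 'I_n) (k : 'I_n.-1) D : 2 < n ->
  ordS (lift i k) != i -> ord_pred (lift i k) != i ->
  tip (lift i k) (extend i D) = tip k D.
Proof.
move=> n_gt2 neS neP.
have lt_cut : liftp i (cut k) = cut (lift i k) by apply: liftp_cut.
have lt12 : (cut k).1 < (cut k).2.
  by rewrite -(ltn_lift i); have := ltn_cut (lift i k) n_gt2; rewrite -lt_cut.
rewrite /tip (perimeter_side_liftp i) // lt_cut -orbA !inE -lt_cut.
by rewrite (mem_imset _ _ (@liftp_inj _ i)).
Qed.

Lemma lift_preimset n (i : 'I_n) (K : {set 'I_n}) :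
  lift i @: (lift i @^-1: K) = K :\ i.
Proof.
apply/setP => k; rewrite !inE; apply/imsetP/andP => [[k' k'K ->]|[ki kK]].
  by rewrite inE in k'K; rewrite eq_sym neq_lift.
have ik : i != k by rewrite eq_sym.
by have [k' def_k _] := unlift_some ik; exists k'; rewrite // inE -def_k.
Qed.

Lemma sparse_preimset n (i : 'I_n) (K : {set 'I_n}) :
  2 < n -> sparse K -> i \in K -> sparse (lift i @^-1: K).
Proof.
move=> n_gt2 spK iK; apply/forall_inP => k; rewrite !inE => kK.
have sK := forall_inP spK _ kK; rewrite lift_ordS //.
by apply: contraNneq sK => ->.
Qed.

(** [K] and its shift by one are disjoint sets of the same size. *)
Lemma card_sparse n (K : {set 'I_n}) : sparse K -> #|K|.*2 <= n.
Proof.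
move=> /forall_inP spK.
have inj : injective (@ordS n) by apply: can_inj (@ordSK n).
rewrite -addnn -{2}(card_imset _ inj) -[X in _ <= X]card_ord.
rewrite -cardsUI [_ :&: _](_ : _ = set0) ?cards0 ?addn0 ?max_card //.
apply/setP => k; rewrite !inE; apply/andP => -[kK /imsetP[j jK def_k]].
by move: (spK j jK); rewrite -def_k kK.
Qed.

Lemma tip_triangle (i : 'I_3) (D : {set 'I_3 * 'I_3}) : tip i D.
Proof.
apply/orP; left; rewrite /perimeter_side.
by case: (cut_cases i (leqnn 3)) => -[? -> ->] //=; lia.
Qed.

Lemma extend_triangulation n (i : 'I_n) (D : {set 'I_n.-1 * 'I_n.-1}) :
  3 < n -> D \in triangulations n.-1 -> extend i D \in triangulations n.
Proof.
move=> n_gt3; rewrite !in_triangulations => /andP[/eqP cardD ncD].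
have ncE := extend_noncrossing i n_gt3 ncD; rewrite ncE andbT.
have cutE : cut i \in extend i D by rewrite !inE eqxx.
rewrite (card_restrict (cut_isolated (ltnW n_gt3) ncE cutE)) cutE.
by rewrite (extendK i (ltnW n_gt3) ncD) cardD; lia.
Qed.

Lemma restrict_triangulation n (i : 'I_n) (D : {set 'I_n * 'I_n}) :
  2 < n -> D \in triangulations n -> cut i \in D ->
  restrict i D \in triangulations n.-1.
Proof.
move=> n_gt2; rewrite !in_triangulations => /andP[/eqP cardD ncD] cutD.
rewrite restrict_noncrossing // andbT.
by have := card_restrict (cut_isolated n_gt2 ncD cutD); rewrite cutD cardD; lia.
Qed.

(** [restrict i] and [extend i] are inverse to each other here; sparsity keeps the other elements of
    [K] away from the neighbours of [i], so they stay tips. *)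
Lemma tipped_extend n (i : 'I_n) (K : {set 'I_n}) :
  3 < n -> sparse K -> i \in K ->
  tipped K = extend i @: tipped (lift i @^-1: K).
Proof.
move=> n_gt3 spK iK; have n_gt2 := ltnW n_gt3.
have tip_lift k D : lift i k \in K -> tip (lift i k) (extend i D) = tip k D.
  move=> kK; apply: tip_extend => //.
    by apply: contraTneq iK => <-; apply: (forall_inP spK).
  by apply: contraTneq iK => <-; apply: sparse_ord_pred.
apply/setP => D; rewrite inE; apply/andP/imsetP => [[TD /forall_inP tipD]|].
  have cutD : cut i \in D by rewrite -tip_diag // tipD.
  have /andP[_ ncD] : (#|D| == n - 3) && noncrossing D.
    by rewrite -in_triangulations.
  have DE := restrictK (cut_isolated n_gt2 ncD cutD) cutD.
  exists (restrict i D); rewrite // inE restrict_triangulation //=.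
  apply/forall_inP => k; rewrite inE => kK.
  by rewrite -tip_lift // DE tipD.
case=> D'; rewrite inE => /andP[TD' /forall_inP tipD'] ->.
split; first exact: extend_triangulation.
apply/forall_inP => k kK; have [->|ki] := eqVneq k i.
  by rewrite tip_diag // !inE eqxx.
have ik : i != k by rewrite eq_sym.
have [k' def_k _] := unlift_some ik.
by rewrite def_k tip_lift -?def_k // tipD' // inE -def_k.
Qed.

(** The elements of [K] are cut off one at a time, each step shrinking the polygon and [K] by
    one. *)
Lemma card_tipped n (K : {set 'I_n}) :
  2 < n -> sparse K -> #|tipped K| = #|triangulations (n - #|K|)|.
Proof.
elim: n K => // n IHn K n_gt1 spK.
have [->|/set0Pn[i iK]] := eqVneq K set0.
  rewrite cards0 subn0; apply: eq_card => D.
  by rewrite inE; case: (_ \in _) => //=; apply/forall_inP => i; rewrite inE.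
(* Base case of the triangle: every vertex is a tip, sparsity forces [K] to be a singleton, and the
   3-gon and the 2-gon each have only the empty triangulation. *)
have [n_gt2|n_le2] := ltnP 2 n; last first.
  have n2 : n = 2 by lia.
  subst n; have K_le1 := card_sparse spK.
  have K_gt0 : 0 < #|K| by apply/card_gt0P; exists i.
  have -> : tipped K = triangulations 3.
    apply/setP => D; rewrite inE -[RHS]andbT; congr andb.
    by apply/forall_inP => k _; apply: tip_triangle.
  by rewrite !triangulations_small ?cards1 //; lia.
rewrite (tipped_extend _ spK iK) // card_in_imset; last first.
  move=> D E; rewrite !inE => /andP[/and3P[_ dD cD] _] /andP[/and3P[_ dE cE] _].
  by move/(congr1 (restrict i)); rewrite !extendK // /noncrossing ?dD ?dE.
rewrite (IHn _ n_gt2 (sparse_preimset _ spK iK)) //; congr #|triangulations _|.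
have := cardsD1 i K; rewrite iK -lift_preimset card_imset; last exact: lift_inj.
by move=> ->; rewrite add1n subSS.
Qed.

(** * Ears and their tips *)

Definition ear_triangle n (i : 'I_n) : 'I_n * 'I_n * 'I_n :=
  let: (a, b) := cut i in
  if i < a then (i, a, b) else if b < i then (a, b, i) else (a, i, b).

Lemma ear_triangle_cases n (i l j r : 'I_n) : 2 < n ->
  ear_triangle i = (l, j, r) ->
  [\/ [/\ cut i = (j, r), i = 0 :> nat, l = 0 :> nat, j = 1 :> nat
         & r = n.-1 :> nat],
      [/\ cut i = (l, j), i.+1 = n, l = 0 :> nat, j = n.-2 :> nat
         & r = n.-1 :> nat]
    | [/\ cut i = (l, r), 0 < i < n.-1, l = i.-1 :> nat, j = i :> nat
         & r = i.+1 :> nat]].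
Proof.
move=> n_gt2; have lt_in := ltn_ord i; have := cut_cases i n_gt2.
rewrite /ear_triangle; case: (cut i) => a b /= -[] [Ei Ea Eb].
- have -> : i < a by lia.
  by move=> /pair_equal_spec[/pair_equal_spec[<- <-] <-];
    constructor 1; split=> //; lia.
- have [-> ->] : (i < a) = false /\ (b < i) = true by lia.
  by move=> /pair_equal_spec[/pair_equal_spec[<- <-] <-];
    constructor 2; split=> //; lia.
have [-> ->] : (i < a) = false /\ (b < i) = false by lia.
by move=> /pair_equal_spec[/pair_equal_spec[<- <-] <-];
    constructor 3; split=> //; lia.
Qed.

(** In a triangle all three vertices would yield the same cell; from [n = 4] on the cell determines
    its tip. *)
Lemma ear_triangle_inj n : 3 < n -> injective (@ear_triangle n).
Proof.
move=> n_gt3 i j; have n_gt2 := ltnW n_gt3; have lt_jn := ltn_ord j.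
case tj: (ear_triangle j) => [[l k] r] /(ear_triangle_cases n_gt2) ti.
have {tj} := ear_triangle_cases n_gt2 tj.
by case: ti => -[_ ? ? ? ?]; case=> -[_ ? ? ? ?]; apply: ord_inj; lia.
Qed.

Definition tips n (D : {set 'I_n * 'I_n}) : {set 'I_n} := [set i | cut i \in D].

(** The tip of an ear is the common vertex of its two perimeter sides, and the remaining side is the
    [cut] of that vertex. *)
Lemma earsE n (D : {set 'I_n * 'I_n}) : 3 < n -> ears D = #|tips D|.
Proof.
move=> n_gt3; have n_gt2 := ltnW n_gt3.
rewrite -(card_imset _ (ear_triangle_inj n_gt3)); apply: eq_card => -[[l j] r].
rewrite !inE /=; apply/andP/imsetP => [[/and5P[lt_lj lt_jr lj jr lr] ge2] | tipE].
  have [lt_ln lt_jn lt_rn] := And3 (ltn_ord l) (ltn_ord j) (ltn_ord r).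
  have eqt (i : 'I_n) (p : 'I_n * 'I_n) :
      p = cut i -> perimeter_side p || (p \in D) ->
      cut i \in D.
    by move=> -> cD; rewrite -tip_diag.
  (* Since [l < j < r], the pair [(l, r)] can only be a side by wrapping around. Then the tip is [l]
     or [r], according to whether [(l, j)] is a side; otherwise the tip is [j]. *)
  have [wrap|nwrap] := boolP (perimeter_side (l, r)).
    have [side_lj|nside_lj] := boolP (perimeter_side (l, j)).
      have cutl : (j, r) = cut l.
        clear eqt lj jr lr.
        apply/eqP; rewrite pair_val_eq.
        case: (cut_cases l n_gt2) => -[? -> ->]; move: wrap side_lj;
          rewrite /perimeter_side /=; lia.
      exists l; first by rewrite inE (eqt l (j, r)).
      by rewrite /ear_triangle -cutl lt_lj.
    have cutr : (l, j) = cut r.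
      clear eqt lj jr lr.
      apply/eqP; rewrite pair_val_eq.
      case: (cut_cases r n_gt2) => -[? -> ->]; move: wrap nside_lj ge2;
        rewrite /perimeter_side /=; lia.
    exists r; first by rewrite inE (eqt r (l, j)).
    rewrite /ear_triangle -cutr lt_jr; case: ltnP => //; lia.
  have cutj : (l, r) = cut j.
    clear eqt lj jr lr.
    apply/eqP; rewrite pair_val_eq.
    case: (cut_cases j n_gt2) => -[? -> ->]; move: nwrap ge2;
      rewrite /perimeter_side /=; lia.
  exists j; first by rewrite inE (eqt j (l, r)).
  rewrite /ear_triangle -cutj; do 2 case: ltnP => //; lia.
case: tipE => i; rewrite inE => cD /esym/(ear_triangle_cases n_gt2).
have lt_in := ltn_ord i.
by case=> -[cutE Ei El Ej Er]; rewrite cutE in cD;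
  rewrite cD ?orbT /perimeter_side /=; split; lia.
Qed.

(** * Binomial moments of the number of ears *)

Definition sparse_count n k : nat :=
  #|[set K : {set 'I_n} | sparse K & #|K| == k]|.

(** Cutting at [i] leaves no diagonal at [i], whereas the cut at the successor of [i] ends at
    [i]. *)
Lemma tips_sparse n (D : {set 'I_n * 'I_n}) (K : {set 'I_n}) :
  3 < n -> noncrossing D -> K \subset tips D -> sparse K.
Proof.
move=> n_gt3 ncD /subsetP sKD; apply/forall_inP => i iK; apply/negP => siK.
have n_gt2 := ltnW n_gt3.
have := sKD _ iK; have := sKD _ siK; rewrite !inE => csD ciD.
have /negP[] := cut_isolated n_gt2 ncD ciD csD.
by rewrite /cut ordSK; case: ifP; rewrite /= eqxx ?orbT.
Qed.

(** Double counting of pairs of a triangulation and a [k]-set of its tips; only sparse sets occur,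
    and each lies in the same number of triangulations. *)
Lemma sum_bin_ears n k : 3 < n ->
  \sum_(D in triangulations n) 'C(ears D, k)
    = sparse_count n k * #|triangulations (n - k)|.
Proof.
move=> n_gt3; have n_gt2 := ltnW n_gt3.
transitivity (\sum_(D in triangulations n)
    \sum_(K : {set 'I_n} | sparse K && (#|K| == k)) (K \subset tips D : nat)).
  apply: eq_bigr => D; rewrite in_triangulations => /andP[_ ncD].
  rewrite earsE // -cards_draws -sum1dep_card big_mkcond [RHS]big_mkcond /=.
  apply: eq_bigr => K _; case: (boolP (K \subset tips D)) => [sKD|_] /=.
    by rewrite (tips_sparse n_gt3 ncD sKD).
  by rewrite if_same.
rewrite exchange_big /= /sparse_count -sum1dep_card big_distrl /=.
apply: eq_bigr => K /andP[spK /eqP <-].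
rewrite mul1n -(card_tipped n_gt2 spK) -sum1dep_card.
rewrite [LHS]big_mkcond [RHS]big_mkcond /=.
apply: eq_bigr => D _; case: (D \in _) => //=; congr (nat_of_bool _).
apply/subsetP/forall_inP => sKD i iK; have := sKD i iK.
  by rewrite inE tip_diag.
by rewrite inE tip_diag.
Qed.

Lemma ears_gt0 n (D : {set 'I_n * 'I_n}) :
  3 < n -> D \in triangulations n -> 0 < ears D.
Proof.
move=> n_gt3 TD; have [i cD] := exists_cut n_gt3 TD.
by rewrite earsE //; apply/card_gt0P; exists i; rewrite inE.
Qed.

(** * Counting sparse subsets of the cycle *)

Definition nadj (a b : bool) : bool := ~~ (a && b).

(** Passing to characteristic vectors allows counting by recursion on the length of a bit
    sequence. *)
Lemma sparse_tuple n (t : n.-tuple bool) :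
  sparse [set i | tnth t i] = cycle nadj t.
Proof.
case: n t => [|n] t; first by rewrite tuple0 /=; apply/forall_inP => -[].
have nth_t := tnth_nth false t.
have size_t : size t = n.+1 := size_tuple t.
have def_t : t = tnth t ord0 :: behead t :> seq bool.
  by rewrite nth_t; case: t {nth_t} size_t => -[].
rewrite def_t /=; set x := tnth t ord0; set p := behead t.
have size_p : size p = n by rewrite size_behead size_t.
(* [rcons p x] lists the cyclic successors of the positions of [t]: the final [x] closes the
   cycle. *)
have nextE i : i < n.+1 ->
    nth false (rcons p x) i = nth false t (if i.+1 == n.+1 then 0 else i.+1).
  rewrite nth_rcons size_p ltnS leq_eqVlt eqSS => /orP[/eqP->|lt_in].
    by rewrite ltnn eqxx /x nth_t.
  by rewrite lt_in (ltn_eqF lt_in) nth_behead.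
have curE i : i < n.+1 -> nth false (x :: rcons p x) i = nth false t i.
  by move=> lt_in; rewrite -rcons_cons -def_t nth_rcons size_t lt_in.
apply/forall_inP/(pathP false) => [sp i | pth i].
  rewrite size_rcons size_p => lt_in; rewrite nextE // curE //.
  have := sp (Ordinal lt_in); rewrite !inE !nth_t val_ordS /= /nadj.
  by case: (nth false t i) => // ->.
rewrite !inE !nth_t val_ordS => ti.
have := pth i; rewrite size_rcons size_p nextE // curE // /nadj ti /=.
exact.
Qed.

Lemma card_tuple_set n (t : n.-tuple bool) : #|[set i | tnth t i]| = count id t.
Proof.
by rewrite -sum1dep_card -sum1_count big_tuple.
Qed.

(* Nonadjacent k-subsets of a path of n vertices, whose outer neighbours are
   occupied or not according to a and b. *)
Definition arc_count a b n k : nat :=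
  \sum_(t : n.-tuple bool) (path nadj a (rcons t b) && (count id t == k)).

Lemma sum_tupleS n (F : n.+1.-tuple bool -> nat) :
  \sum_t F t =
  \sum_(t : n.-tuple bool) (F [tuple of true :: t] + F [tuple of false :: t]).
Proof.
rewrite (reindex (fun p : bool * n.-tuple bool => [tuple of p.1 :: p.2])) /=;
  last first.
  exists (fun t => (thead t, [tuple of behead t])) => [[b t]|t] _ /=.
    by congr pair; apply: val_inj.
  by rewrite -tuple_eta.
rewrite -(pair_bigA _ (fun (b : bool) (t : n.-tuple bool) => F [tuple of b :: t])) /=.
rewrite exchange_big /=.
by apply: eq_bigr => t _; rewrite big_bool.
Qed.

(** Split on whether the first vertex is chosen. The others form a path, and both outer neighbours
    of this path are that first vertex. *)
Lemma sparse_countS n k :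
  sparse_count n.+1 k.+1 =
  arc_count true true n k + arc_count false false n k.+1.
Proof.
rewrite /sparse_count -sum1dep_card.
rewrite (reindex (fun t : n.+1.-tuple bool => [set i | tnth t i])) /=;
  last first.
  exists (fun K : {set 'I_n.+1} => [tuple i \in K | i < n.+1]) => [t|K] _.
    by apply: eq_from_tnth => i; rewrite tnth_mktuple inE.
  by apply/setP => i; rewrite inE tnth_mktuple.
rewrite big_mkcond sum_tupleS big_split; congr (_ + _);
by apply: eq_bigr => t _; rewrite sparse_tuple card_tuple_set /=
        ?eqSS ?add0n; case: ifP.
Qed.

Lemma arc_count0 a b k : arc_count a b 0 k = nadj a b && (k == 0).
Proof.
rewrite /arc_count (big_pred1 [tuple]) /= => [|t]; first by rewrite andbT eq_sym.
by apply/esym/eqP; exact: tuple0.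
Qed.

Lemma arc_countS0 a b n : arc_count a b n.+1 0 = arc_count false b n 0.
Proof.
rewrite /arc_count sum_tupleS; apply: eq_bigr => t _ /=.
by rewrite andbF /nadj andbF !add0n.
Qed.

Lemma arc_countSS a b n k : arc_count a b n.+1 k.+1 =
  ~~ a * arc_count true b n k + arc_count false b n k.+1.
Proof.
rewrite /arc_count sum_tupleS big_split /= big_distrr; congr (_ + _);
apply: eq_bigr => t _ /=; rewrite /nadj ?andbF //.
by rewrite add1n eqSS; case: a; rewrite /= ?mul1n.
Qed.

Lemma arc_countS_true b n k : arc_count true b n.+1 k = arc_count false b n k.
Proof. by case: k => [|k]; rewrite (arc_countS0, arc_countSS). Qed.

(** Pascal's rule; when the subtraction truncates, [k] is positive and all three binomials
    vanish. *)
Lemma bin_diag_rec m k : 'C(m - k, k) + 'C(m - k, k.+1) = 'C(m.+1 - k, k.+1).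
Proof.
have [le_km|lt_mk] := leqP k m; first by rewrite subSn // binS addnC.
have [-> ->] : m - k = 0 /\ m.+1 - k = 0 by split; lia.
by case: k lt_mk.
Qed.

(** An occupied outer neighbour forces the adjacent end of the path to be empty, shortening it by
    one. The case [n = 0] is separate in the last count, where the two occupied neighbours are
    themselves adjacent. *)
Lemma arc_countE n k :
  [/\ arc_count false false n k = 'C(n.+1 - k, k),
      arc_count true false n k = 'C(n - k, k),
      arc_count false true n k = 'C(n - k, k)
    & arc_count true true n k = if n is n'.+1 then 'C(n' - k, k) else 0].
Proof.
elim: n k => [|n IHn] k; first by rewrite !arc_count0; split; case: k => [|[]].
rewrite !arc_countS_true; case: k => [|k].
  have [ff tf ft tt] := IHn 0.
  by rewrite !arc_countS0 ff ft !bin0.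
have [ff _ ft _] := IHn k.+1; have [_ tf _ tt] := IHn k.
rewrite !arc_countSS !mul1n ff ft tf tt !subSS; split=> //.
  by rewrite bin_diag_rec.
by case: n {IHn ff ft tf tt} => [|n]; rewrite ?bin0n // subSS bin_diag_rec.
Qed.

Lemma sparse_count0 n : sparse_count n 0 = 1.
Proof.
rewrite /sparse_count (_ : [set K | _] = [set set0]) ?cards1 //.
apply/setP => K; rewrite !inE cards_eq0 andbC; case: eqP => //= ->.
by apply/forall_inP => i; rewrite inE.
Qed.

(** Pascal's rule brings the count to the shape of the coefficients in the generating function, with
    [j = n - 3 - k]. *)
Lemma sparse_countE n k : 1 < n ->
  sparse_count n k.+1 = 'C(n - 2 - k, k.+1) + 2 * 'C(n - 2 - k, k).
Proof.
case: n => [|[|n]] // _; rewrite sparse_countS addnC !subSS subn0.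
have [-> _ _ _] := arc_countE n.+1 k.+1; have [_ _ _ ->] := arc_countE n.+1 k.
by rewrite subSS -bin_diag_rec; lia.
Qed.

(** * Binomial and Catalan identities *)

(** With [m = j + k] this reads [C(j + 1, k) * Cat_j = C(m, k) * C(2 j, m - 1) / m], which matches
    Catalan terms with those of [alternating_bin_sum]. *)
Lemma mul_bin_central j k : 0 < j + k ->
  (j + k) * 'C(j.+1, k) * 'C(2 * j, j) =
  j.+1 * 'C(j + k, k) * 'C(2 * j, (j + k).-1).
Proof.
move=> jk_gt0; have [le_kj|lt_jk] := leqP k j.+1; last first.
  by rewrite (bin_small lt_jk) (@bin_small (2 * j) (j + k).-1) ?muln0; lia.
(* This product clears the denominators of the binomials on both sides. *)
have fact_gt0 : 0 < k`! * (j.+1 - k)`! * j`! * j`! * (j + k).-1`!.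
  by rewrite !muln_gt0 !fact_gt0.
have e1 : 'C(j.+1, k) * (k`! * (j.+1 - k)`!) = j.+1 * j`!.
  by rewrite bin_fact // factS.
have e2 : 'C(2 * j, j) * (j`! * j`!) = (2 * j)`!.
  by have := @bin_fact (2 * j) j; rewrite (_ : 2 * j - j = j); [apply|]; lia.
have e3 : 'C(j + k, k) * (k`! * j`!) = (j + k) * (j + k).-1`!.
  have := @bin_fact (j + k) k; rewrite addnK => -> //; last exact: leq_addl.
  by case: (j + k) jk_gt0 => // n _; rewrite factS.
have e4 : 'C(2 * j, (j + k).-1) * ((j + k).-1`! * (j.+1 - k)`!) = (2 * j)`!.
  have := @bin_fact (2 * j) (j + k).-1.
  by rewrite (_ : 2 * j - (j + k).-1 = j.+1 - k); [apply|]; lia.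
apply/eqP; rewrite -(eqn_pmul2r fact_gt0); apply/eqP.
transitivity ((j + k) * (j + k).-1`! * ('C(j.+1, k) * (k`! * (j.+1 - k)`!)) *
  ('C(2 * j, j) * (j`! * j`!))); first by ring.
rewrite e1 e2 -e3 -e4; ring.
Qed.

Local Open Scope ring_scope.

Lemma coef_1DXn (R : comNzRingType) n i :
  ((1 + 'X : {poly R}) ^+ n)`_i = 'C(n, i)%:R.
Proof.
rewrite exprDn coef_sum.
under eq_bigr => j _ do rewrite expr1n mul1r coefMn coefXn.
have [lt_in|le_ni] := ltnP i n.+1.
  rewrite (bigD1 (Ordinal lt_in)) //= eqxx big1 ?addr0 // => j ne.
  rewrite -val_eqE /= in ne; by rewrite eq_sym (negbTE ne) mul0rn.
rewrite big1 ?bin_small // => j _.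
by rewrite gtn_eqF ?mul0rn // (leq_trans (ltn_ord j)).
Qed.

(** Binomial expansion of [((1 + X)^2 - 1)^m] gives the sum as a coefficient of degree [m - 1], but
    the polynomial equals [X^m * (X + 2)^m]. *)
Lemma alternating_bin_sum (R : comNzRingType) m : (0 < m)%N ->
  \sum_(k < m.+1) (-1) ^+ k * ('C(m, k) * 'C(2 * (m - k), m.-1))%:R = 0 :> R.
Proof.
move=> m_gt0.
have : ((((1 + 'X : {poly R}) ^+ 2) - 1) ^+ m)`_m.-1 = 0.
  rewrite (_ : _ - 1 = 'X * ('X + 2%:R)); last by ring.
  by rewrite exprMn coefXnM prednK // leqnn.
rewrite exprBn coef_sum => sum0; rewrite -[RHS]sum0; apply: eq_bigr => k _.
rewrite expr1n mulr1 -exprM coefMn.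
rewrite (_ : (-1) ^+ k * (1 + 'X) ^+ (2 * (m - k)) =
    ((-1) ^+ k)%:P * (1 + 'X) ^+ (2 * (m - k)) :> {poly R}); last first.
  by rewrite rmorphXn rmorphN1.
by rewrite coefCM coef_1DXn natrM -mulr_natr; ring.
Qed.

Section Catalan.

Variable F : numFieldType.

Lemma catalan_alternating_sum m : (0 < m)%N ->
  \sum_(k < m.+1) (-1) ^+ k * 'C(m.+1 - k, k)%:R * catalan F (m - k) = 0.
Proof.
move=> m_gt0; have m_neq0 : m%:R != 0 :> F by rewrite pnatr_eq0 -lt0n.
apply: (mulfI m_neq0); rewrite mulr0 mulr_sumr.
rewrite -[RHS](@alternating_bin_sum F m) //; apply: eq_bigr => k _.
have le_km : (k <= m)%N by rewrite -ltnS.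
have := @mul_bin_central (m - k) k; rewrite subnK // => /(_ m_gt0) eq_nat.
have := congr1 (fun a => a%:R : F) eq_nat; rewrite !natrM -subSn // => eq_F.
have mk_neq0 : (m - k).+1%:R != 0 :> F by rewrite pnatr_eq0.
rewrite /catalan; apply: (mulfI mk_neq0); rewrite subSn // in eq_F *.
transitivity ((-1) ^+ k *
    (m%:R * 'C((m - k).+1, k)%:R * 'C(2 * (m - k), m - k)%:R : F)).
  by move: mk_neq0; move: (_.+1%:R) => N N_neq0; field.
by rewrite eq_F; ring.
Qed.

Lemma catalanS k :
  catalan F k.+1 = 2 * (2 * k%:R + 1) / (k%:R + 2) * catalan F k.
Proof.
have e1 : (k.+1 * 'C(2 * k.+1, k.+1) = 2 * k.+1 * 'C((2 * k).+1, k.+1))%N.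
  rewrite mulnS -mul_bin_diag /=; congr (_ * _)%N.
  by rewrite -[in LHS]bin_sub; [congr ('C(_, _))|]; lia.
have e2 : (k.+1 * 'C((2 * k).+1, k.+1) = (2 * k).+1 * 'C(2 * k, k))%N.
  by rewrite -mul_bin_diag.
have := congr1 (fun a => a%:R : F) e1; have := congr1 (fun a => a%:R : F) e2.
rewrite /catalan !natrM; set A := 'C(2 * k.+1, _)%:R; set B := 'C(_.+1, _)%:R.
set C := 'C(2 * k, k)%:R => eB eA.
have k1 : k%:R + 1 != 0 :> F by rewrite natr1 pnatr_eq0.
have k2 : k%:R + 2 != 0 :> F by rewrite -natrD pnatr_eq0 addnC.
have -> : A = 2 * ((2 * k%:R + 1) * C / (k%:R + 1)).
  have -> : A = 2 * B.
    by apply: (@mulfI _ (k.+1%:R)); rewrite ?pnatr_eq0 // eA; ring.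
  congr (2 * _); apply: (@mulfI _ (k.+1%:R)); rewrite ?pnatr_eq0 // eB.
  by rewrite -[k.+1%:R]natr1 -[(2 * k).+1%:R]natr1 natrM; field.
rewrite -[k.+1%:R]natr1 -[k.+2%:R]natr1 -[k.+1%:R]natr1; field.
by rewrite k1.
Qed.

End Catalan.

(** Writing [n = m + 3] and [S] for the sum in [catalan_alternating_sum], the two terms of
    [sparse_countE] give [S (m + 1) - 2 * S m]. *)
Lemma sum_sparse_count_catalan (F : numFieldType) n : (3 < n)%N ->
  \sum_(k < n.-1) (-1) ^+ k * (sparse_count n k)%:R * catalan F (n - 2 - k) = 0.
Proof.
case: n => [|[|[|m]]] // m_gt0; rewrite [m.+3.-1]/= [(m.+3 - 2)%N]/=.
have := @catalan_alternating_sum F m.+1 isT; rewrite big_ord_recl => sum1.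
have sum0 := @catalan_alternating_sum F m m_gt0.
rewrite big_ord_recl sparse_count0 -[RHS]sum1 !subn0 bin0; congr (_ + _).
transitivity (\sum_(k < m.+1) (-1) ^+ lift ord0 k *
      'C(m.+2 - lift ord0 k, lift ord0 k)%:R *
      catalan F (m.+1 - lift ord0 k)
    - 2 * \sum_(k < m.+1) (-1) ^+ k * 'C(m.+1 - k, k)%:R * catalan F (m - k)).
  rewrite mulr_sumr -sumrB; apply: eq_bigr => k _.
  by rewrite /= /bump /= add1n !subSS sparse_countE // !subSS subn0 natrD natrM exprS;
    ring.
by rewrite sum0 mulr0 subr0.
Qed.

(** * The generating function and the number of triangulations *)

(** A range independent of the exponent lets the sum be exchanged with the one over
    triangulations. *)
Lemma exprD1_bound (R : comNzRingType) (x : R) e M : (e < M)%N ->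
  (1 + x) ^+ e = \sum_(k < M) 'C(e, k)%:R * x ^+ k.
Proof.
move=> lt_eM; rewrite exprDn.
rewrite (big_ord_widen_cond M xpredT
           (fun k => 1 ^+ (e - k) * x ^+ k *+ 'C(e, k))) //.
rewrite big_mkcond /=; apply: eq_bigr => k _; rewrite expr1n mul1r.
case: ltnP => [_|lt_ek]; first by rewrite mulr_natl.
by rewrite bin_small ?mul0r.
Qed.

Lemma sum_expr_ears (R : comNzRingType) n (x : R) : (3 < n)%N ->
  \sum_(D in triangulations n) (1 + x) ^+ ears D =
  \sum_(k < n.-1) x ^+ k * (sparse_count n k)%:R * #|triangulations (n - k)|%:R.
Proof.
move=> n_gt3.
transitivity (\sum_(D in triangulations n)
    \sum_(k < n.-1) 'C(ears D, k)%:R * x ^+ k).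
  apply: eq_bigr => D; rewrite in_triangulations => /andP[_ ncD].
  (* The tips form a sparse set, so there are at most [n / 2] ears, fewer than [n - 1]. *)
  apply: exprD1_bound; rewrite earsE //.
  by have := card_sparse (tips_sparse n_gt3 ncD (subxx _)); lia.
rewrite exchange_big; apply: eq_bigr => k _ /=.
by rewrite -mulr_suml -natr_sum sum_bin_ears // natrM; ring.
Qed.

Lemma card_triangulations (F : numFieldType) n : (1 < n)%N ->
  #|triangulations n|%:R = catalan F (n - 2).
Proof.
elim/ltn_ind: n => n IHn n_gt1; have [n_le3|n_gt3] := leqP n 3.
  rewrite triangulations_small // cards1 /catalan.
  have [->|->] : n = 2%N \/ n = 3%N by lia.
    by rewrite !subnn muln0 bin0 divr1.
  by rewrite -[(3 - 2)%N]/1%N muln1 bin1 divff // pnatr_eq0.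
(* At [x = -1] every summand is a positive power of [0], which leaves a recurrence for the numbers
   of triangulations. *)
have := @sum_expr_ears F n (-1) n_gt3; rewrite subrr.
rewrite big1 => [|D TD]; last by rewrite expr0n gtn_eqF // ears_gt0.
move=> sum_t; have sum_c := sum_sparse_count_catalan F n_gt3.
case: n n_gt3 n_gt1 IHn sum_t sum_c => [|[|n]] // n_gt3 _ IHn.
rewrite !big_ord_recl sparse_count0 !subn0 !mul1r => sum_t sum_c.
(* The counts and the Catalan numbers satisfy the same recurrence; by induction their tails agree,
   hence so do their leading terms. *)
apply: (addIr (\sum_(i < n) (-1) ^+ lift ord0 i *
           (sparse_count n.+2 (lift ord0 i))%:R *
           catalan F (n.+2 - 2 - lift ord0 i))).
rewrite sum_c [RHS]sum_t; congr (_ + _); apply: eq_bigr => k _; rewrite IHn.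
- by congr (_ * catalan _ _); rewrite /bump /=; lia.
- by rewrite /= /bump /=; lia.
- by have := ltn_ord k; rewrite /= /bump /=; lia.
Qed.

Lemma catalan_neq0 (F : numFieldType) k : catalan F k != 0.
Proof.
by rewrite mulf_neq0 ?invr_eq0 ?pnatr_eq0 // -lt0n bin_gt0; lia.
Qed.

(** * The formulas for the generating function, mean and variance *)

Lemma ear_pgfE (R : realType) n (z : R[i]) : (3 < n)%N ->
  ear_pgf n z = 1 + (catalan R[i] (n - 2))^-1 *
    \sum_(0 <= j < (n - 3).+1) catalan R[i] j *
      ('C(j + 1, n - 2 - j)%:R + 2 * 'C(j + 1, n - 3 - j)%:R) *
      (z - 1) ^+ (n - 2 - j).
Proof.
move=> n_gt3; rewrite /ear_pgf /uexpect -[z in LHS](subrKC 1) sum_expr_ears //.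
rewrite card_triangulations; last by lia.
case: n n_gt3 => [|[|[|n]]] // _; rewrite !subSS !subn0.
rewrite big_ord_recl sparse_count0 subn0 expr0 !mul1r card_triangulations //.
rewrite !subSS subn0 mulrDl divff ?catalan_neq0 // mulrC; congr (_ + _ * _).
(* The term without tips gave the leading [1]; reversing the sum makes [j] the Catalan index left
   after removing [n - 2 - j] tips. *)
rewrite big_nat_rev /= big_mkord; apply: eq_bigr => k _.
have lt_kn := ltn_ord k; rewrite add0n subSS.
rewrite card_triangulations /= /bump /=; last by lia.
rewrite sparse_countE // add1n !subSS subn0.
have -> : (n.+1 - (n - k) = k.+1)%N by lia.
have -> : (n - (n - k) = k)%N by lia.
have -> : (n - k + 1 = n.+1 - k)%N by lia.
have -> : (n.+2 - k - 2 = n - k)%N by lia.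
by rewrite natrD natrM; ring.
Qed.

Lemma sum_ears (F : numFieldType) n : (3 < n)%N ->
  \sum_(D in triangulations n) (ears D)%:R = n%:R * catalan F (n - 3).
Proof.
move=> n_gt3; have := sum_bin_ears 1 n_gt3.
rewrite sparse_countE; last by lia.
under eq_bigr do rewrite bin1.
rewrite subn0 bin1 bin0 (_ : n - 2 + 2 * 1 = n)%N; last by lia.
move/(congr1 (fun a => a%:R : F)); rewrite natr_sum natrM => ->.
rewrite card_triangulations; last by lia.
by congr (_ * catalan _ _); lia.
Qed.

Lemma bin2E (F : numFieldType) e : 'C(e, 2)%:R = e%:R * (e%:R - 1) / 2 :> F.
Proof.
have := congr1 (fun a => a%:R : F) (mul_bin_diag e 1).
rewrite bin1 !natrM; case: e => [|e] /= e2.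
  by rewrite !mul0r.
have two_neq0 : 2 != 0 :> F by rewrite pnatr_eq0.
by apply: (mulfI two_neq0); rewrite -e2 -natr1; field.
Qed.

Lemma sum_ears_sq (F : numFieldType) n : (4 < n)%N ->
  \sum_(D in triangulations n) (ears D)%:R ^+ 2 =
  n%:R * (n%:R - 3) * catalan F (n - 4) + n%:R * catalan F (n - 3).
Proof.
move=> n_gt4; have n_gt3 := ltnW n_gt4.
(* The square is [2 * C(e, 2) + e], which reduces it to the first two binomial moments. *)
transitivity (\sum_(D in triangulations n)
    (2 * 'C(ears D, 2)%:R + (ears D)%:R : F)).
  by apply: eq_bigr => D _; rewrite bin2E; field.
rewrite big_split /= sum_ears // -mulr_sumr -natr_sum sum_bin_ears // natrM.
rewrite card_triangulations; last by lia.
rewrite sparse_countE; last by lia.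
rewrite natrD natrM bin1 bin2E (_ : n - 2 - 1 = n - 3)%N; last by lia.
rewrite natrB; last by lia.
by rewrite -subnDA; congr (_ + _); field.
Qed.

Theorem lemma4 (R : realType) :
  [/\ forall (n : nat) (z : R[i]), (4 <= n)%N ->
        ear_pgf n z =
          1 + (catalan R[i] (n - 2))^-1 *
              \sum_(0 <= j < (n - 3).+1)
                 catalan R[i] j *
                 ('C(j + 1, n - 2 - j)%:R + 2 * 'C(j + 1, n - 3 - j)%:R) *
                 (z - 1) ^+ (n - 2 - j),
      forall n : nat, (4 <= n)%N ->
        uexpect (triangulations n) (fun D => (ears D)%:R : R) =
          n%:R * (n%:R - 1) / (2 * (2 * n%:R - 5))
    & forall n : nat, (6 <= n)%N ->
        uvariance (triangulations n) (fun D => (ears D)%:R : R) =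
          n%:R * (n%:R - 1) * (n%:R - 4) * (n%:R - 5)
            / (2 * (2 * n%:R - 5) ^+ 2 * (2 * n%:R - 7))].
Proof.
have mean n : (4 <= n)%N ->
        uexpect (triangulations n) (fun D => (ears D)%:R : R) =
          n%:R * (n%:R - 1) / (2 * (2 * n%:R - 5)).
  move=> n_gt3; rewrite /uexpect sum_ears // card_triangulations; last by lia.
  (* Both Catalan numbers become multiples of one nonzero [c], which cancels. *)
  case: n n_gt3 => [|[|[|n]]] // _; rewrite !subSS !subn0 catalanS.
  have := catalan_neq0 R n; move: (catalan R n) => c c_neq0.
  have n_ge0 := ler0n R n.
  rewrite -addn3 natrD; field; rewrite c_neq0 /=; apply/and3P; split=> //;
    apply: lt0r_neq0; lra.
split=> [n z n_gt3 | // | n n_gt5]; first exact: ear_pgfE.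
have n_gt3 : (3 < n)%N by lia.
rewrite /uvariance mean //; set mu := _ / _.
(* Expanding the square about the mean leaves only the first two power sums. *)
transitivity ((\sum_(D in triangulations n) (ears D)%:R ^+ 2
    - 2 * mu * \sum_(D in triangulations n) (ears D)%:R
    + \sum_(D in triangulations n) mu ^+ 2) / #|triangulations n|%:R).
  rewrite /uexpect mulr_sumr -sumrB -big_split /=; congr (_ / _).
  by apply: eq_bigr => D _; ring.
rewrite sumr_const sum_ears_sq ?sum_ears //; last by lia.
rewrite -[mu ^+ 2 *+ _]mulr_natr card_triangulations; last by lia.
(* Shifting [n] by 4 makes the smallest Catalan index [n]; the others reduce to it, leaving an
   identity of rational functions whose denominators are positive. *)
rewrite /mu {mu}; case: n n_gt5 n_gt3 => [|[|[|[|n]]]] // n_gt1 _.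
rewrite !subSS !subn0 !catalanS.
have := catalan_neq0 R n; move: (catalan R n) => c c_neq0.
have n_ge0 : 2 <= n%:R :> R by rewrite ler_nat.
rewrite -[n.+1%:R]natr1 -addn4 natrD; field; rewrite c_neq0 /=.
do ?[apply/andP; split]; rewrite ?c_neq0 //; apply: lt0r_neq0; lra.
Qed.
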